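(* Let $n\ge2$ be an integer. There exist a constant $\kappa=\kappa(n)>0$ and a number $T_0=T_0(n)\ge 1$, depending only on $n$, such that for all real $T\ge T_0$, $$\frac{1}{N(T)}\sum_{A\in Q(T)}\ \max_{\boldsymbol c\in\mathbb{Q}^n,\ \boldsymbol c\ne\boldsymbol 0}\frac{\mathrm{Gap}_{\boldsymbol c}(A)}{\|A\|_\infty^{1/(n-1)}\|\boldsymbol c\|_1}\ge \kappa .$$
   Context: For $A=(a_1,\ldots,a_n)\in\mathbb{Z}^{1\times n}$ with positive entries, $b\in\mathbb{Z}$ and $\boldsymbol c\in\mathbb{Q}^n$, let $IP_{\boldsymbol c}(A,b)=\min\{\boldsymbol c\cdot\boldsymbol x: A\boldsymbol x=b,\ \boldsymbol x\in\mathbb{Z}^n_{\ge0}\}$ and $LP_{\boldsymbol c}(A,b)=\min\{\boldsymbol c\cdot\boldsymbol x: A\boldsymbol x=b,\ \boldsymbol x\in\mathbb{R}^n_{\ge0}\}$. When the integer problem is feasible and bounded, $IG_{\boldsymbol c}(A,b)=IP_{\boldsymbol c}(A,b)-LP_{\boldsymbol c}(A,b)$. The integer programming gap is $\mathrm{Gap}_{\boldsymbol c}(A)=\max_b IG_{\boldsymbol c}(A,b)$, where $b$ ranges over all integers for which the integer problem is feasible and bounded. $\|A\|_\infty=\max_i|a_i|$ and $\|\boldsymbol c\|_1=\sum_i|c_i|$. For $T\ge1$ let $Q(T)$ be the set of all $A=(a_1,\ldots,a_n)\in\mathbb{Z}^{1\times n}$ with all $a_i>0$, $\gcd(a_1,\ldots,a_n)=1$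 and $\|A\|_\infty\le T$, and let $N(T)=\#Q(T)$. *)

(* Defs.v *)
From mathcomp Require Import all_boot all_order all_algebra.
From mathcomp Require Import finmap.
From mathcomp Require Import all_classical all_reals all_analysis.

Set Implicit Arguments.
Unset Strict Implicit.
Unset Printing Implicit Defensive.

Import Order.TTheory GRing.Theory Num.Theory.
Local Open Scope classical_set_scope.
Local Open Scope ring_scope.

(* [set_max] and [set_min] are attained extrema, unlike [sup] and [inf]; they
   take the conventional value 0 when the extremum is not attained. *)
Definition set_max (R : realType) (S : set R) : R :=
  xget 0 [set m | S m /\ ubound S m].

Definition set_min (R : realType) (S : set R) : R :=
  xget 0 [set m | S m /\ lbound S m].

Section IntegerProgrammingGap.
Context (R : realType) (n : nat).
Implicit Types (A : 'rV[int]_n) (b : int) (c : 'cV[rat]_n).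

Definition dot c (x : 'cV[R]_n) : R := \sum_(i < n) ratr (c i 0) * x i 0.

Definition IP_values c A b : set R :=
  [set dot c (map_mx intr x) | x in
    [set x : 'cV[int]_n | A *m x = b%:M /\ forall i, 0 <= x i 0]].

Definition LP_values c A b : set R :=
  [set dot c x | x in
    [set x : 'cV[R]_n |
      map_mx intr A *m x = (b%:~R)%:M /\ forall i, 0 <= x i 0]].

Definition IP c A b : R := set_min (IP_values c A b).

Definition LP c A b : R := set_min (LP_values c A b).

Definition IG c A b : R := IP c A b - LP c A b.

(* [has_inf (IP_values c A b)] says that the integer problem is feasible
   (nonempty set of values) and bounded (its values are bounded below). *)
Definition Gap c A : R :=
  set_max [set IG c A b | b in [set b : int | has_inf (IP_values c A b)]].

Definition norm1 c : rat := \sum_(i < n) `|c i 0|.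

(* [mx_norm A] is the maximum of the absolute values of the entries of [A]. *)
Definition Q (T : R) : set 'rV[int]_n :=
  [set A : 'rV[int]_n | [/\ forall i, 0 < A 0 i,
               \big[gcdz/0]_(i < n) A 0 i = 1
             & (mx_norm A)%:~R <= T]].

Definition N (T : R) : nat := #|` fset_set (Q T)|.

Definition max_gap_ratio A : R :=
  set_max [set Gap c A /
               (((mx_norm A)%:~R `^ (n%:R - 1)^-1) * ratr (norm1 c))
          | c in [set c : 'cV[rat]_n | c != 0]].

End IntegerProgrammingGap.

Arguments Q {R} n T.
Arguments N {R} n T.
Arguments max_gap_ratio R {n} A.

(* Main.v *)
Require Import Defs.
From mathcomp Require Import all_boot all_order all_algebra.
From mathcomp Require Import finmap.
From mathcomp Require Import all_classical all_reals all_analysis.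
From mathcomp Require Import ring lra zify.

Import Order.TTheory GRing.Theory Num.Theory.
Local Open Scope classical_set_scope.
Local Open Scope ring_scope.

(** Let [M = a_i] be the largest entry of [A] and let [c_j = 1] for [j != i],
    [c_i = 0].  The linear relaxation has value 0, and an integer point with
    value less than [u] has its other coordinates below [u], so these points
    meet at most [u ^ (n - 1)] residue classes modulo [M].  If [u ^ (n - 1) < M]
    some solvable right-hand side lies in another class, whence [Gap >= u].
    Taking [u] close to [M ^ (1 / (n - 1))] bounds the ratio from below by
    [1 / (2 (n - 1))] for every [A] except the all-ones vector.

    Since [set_max] has the junk value 0 on sets without a maximum, one must
    also show that the maximum over rational [c] is attained.  Only finitely
    many right-hand sides [b] matter, independently of [c], so [Gap] is a finite
    maximum over [(b, i)] of finite minima, over the solutions [x] for [b], of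
    the linear forms [c *m x - c_i b / a_i].  Each such minimum is maximised
    over the unit ball of [norm1] by a rational linear program, whose optimum is
    attained at a rational point by Fourier-Motzkin elimination. *)

(** * Extrema of finite sequences *)

Lemma seq_minimizer {d} {F : orderType d} {T : eqType} (f : T -> F) {s : seq T} :
  s != [::] -> exists2 x, x \in s & {in s, forall y, (f x <= f y)%O}.
Proof.
elim: s => // z s IHs _; have [->|/IHs[x xs xmin]] := eqVneq s [::].
  by exists z; rewrite ?mem_head// => y; rewrite inE => /eqP->.
have [fzx|fxz] := leP (f z) (f x).
  exists z; rewrite ?mem_head// => y; rewrite inE => /predU1P[->//|/xmin].
  exact: le_trans.
exists x; first by rewrite inE xs orbT.
by move=> y; rewrite inE => /predU1P[->|/xmin//]; exact: ltW.
Qed.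

(** The largest element of [lo] separates, or the smallest element of [hi] when [lo] is empty. This
    decides whether one variable can satisfy given lower and upper bounds. *)
Lemma seq_separation {F : realDomainType} (lo hi : seq F) :
  {in lo & hi, forall l h, l <= h} ->
  exists y, {in lo, forall l, l <= y} /\ {in hi, forall h, y <= h}.
Proof.
elim: lo => [_|l lo IHlo lohi].
  have [->|/(seq_minimizer id)[y _ ymin]] := eqVneq hi [::]; first by exists 0.
  by exists y; split.
have [|y [loy yhi]] := IHlo.
  by move=> a b alo; apply: lohi; rewrite inE alo orbT.
exists (Num.max l y); split=> [a|a ahi]; last first.
  by rewrite ge_max yhi// lohi// mem_head.
by rewrite inE le_max => /predU1P[->|/loy->]; rewrite ?lexx ?orbT.
Qed.

(** * Fourier-Motzkin elimination *)

Section FourierMotzkin.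
Context {F : realFieldType} {n : nat}.
Implicit Types (x : 'cV[F]_n) (t : F) (p q : 'rV[F]_n * F * F).
Implicit Types L : seq ('rV[F]_n * F * F).

(* [(r, b, g)] encodes the inequality [r *m x <= b + g * t] in [(x, t)]. *)
Definition slack p x t : F := p.1.2 + p.2 * t - (p.1.1 *m x) 0 0.

Definition slope p x : F := (p.1.1 *m x) 0 0.

Definition feasible L x t := all (fun p => 0 <= slack p x t) L.

Let entryD (B C : 'M[F]_1) : (B + C) 0 0 = B 0 0 + C 0 0.
Proof. exact: mxE. Qed.

Let entryZ a (B : 'M[F]_1) : (a *: B) 0 0 = a * B 0 0.
Proof. exact: mxE. Qed.

Lemma slack_translate p x d y t :
  slack p (x + y *: d) t = slack p x t - y * slope p d.
Proof.
by rewrite /slack /slope mulmxDr -scalemxAr entryD entryZ; ring.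
Qed.

(** The multipliers make the slope along [d] cancel; they are positive when [p] slopes up and [q]
    slopes down, so the combination follows from [p] and [q]. *)
Definition combine d p q :=
  (slope p d *: q.1.1 - slope q d *: p.1.1,
   slope p d * q.1.2 - slope q d * p.1.2,
   slope p d * q.2 - slope q d * p.2).

Lemma slack_combine d p q x t :
  slack (combine d p q) x t = slope p d * slack q x t - slope q d * slack p x t.
Proof.
rewrite /slack /= mulmxBl -!scalemxAl -scaleNr entryD !entryZ.
by ring.
Qed.

(** An inequality of positive slope bounds [y] above by its slack over its slope, one of negative
    slope bounds it below. A suitable [y] exists iff each lower bound is at most each upper bound,
    which is what [combine] expresses. *)
Lemma eliminate_direction L d : exists L', forall x t,
  (exists y, feasible L (x + y *: d) t) <-> feasible L' x t.
Proof.
pose up := [seq p <- L | 0 < slope p d].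
pose down := [seq p <- L | slope p d < 0].
exists ([seq p <- L | slope p d == 0] ++ [seq combine d p q | p <- up, q <- down]).
move=> x t; rewrite /feasible all_cat; split.
  move=> [y /allP Ly]; apply/andP; split; apply/allP=> p.
    rewrite mem_filter => /andP[/eqP sp pL].
    by have := Ly p pL; rewrite slack_translate sp mulr0 subr0.
  case/allpairsP=> -[u v] [/=]; rewrite !mem_filter.
  move=> /andP[su /Ly + /andP[sv /Ly +]] ->.
  by rewrite !slack_translate slack_combine; nra.
case/andP=> /allP L0 /allP Lud.
have [|y [lo hi]] := @seq_separation F
    [seq slack p x t / slope p d | p <- down]
    [seq slack p x t / slope p d | p <- up].
  move=> _ _ /mapP[q qd ->] /mapP[p pu ->].
  have := Lud _ (allpairs_f (combine d) pu qd); rewrite slack_combine.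
  move: pu qd; rewrite !mem_filter => /andP[sp _] /andP[sq _].
  by rewrite ler_pdivlMr// mulrAC ler_ndivrMr//; lra.
exists y; apply/allP => p pL; rewrite slack_translate subr_ge0.
have [sp|sp|sp] := ltgtP (slope p d) 0.
- by rewrite -ler_ndivrMr//; apply: lo; apply: map_f; rewrite mem_filter sp.
- by rewrite -ler_pdivlMr//; apply: hi; apply: map_f; rewrite mem_filter sp.
- by rewrite sp mulr0; apply: L0; rewrite mem_filter sp eqxx.
Qed.

(** Restricting [z] to the support [I] lets coordinates be eliminated one at a time without changing
    the dimension. *)
Lemma eliminate_coordinates (I : seq 'I_n) L : exists L', forall x t,
  (exists2 z : 'cV_n, forall i, i \notin I -> z i 0 = 0 & feasible L (x + z) t) <->
  feasible L' x t.
Proof.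
elim: I L => [|j I IHI] L.
  exists L => x t; split=> [[z z0 Lx]|Lx].
    by move: Lx; rewrite (_ : z = 0) ?addr0//; apply/colP=> i; rewrite z0 ?mxE.
  by exists 0; rewrite ?addr0// => i _; rewrite mxE.
have [L1 L1P] := eliminate_direction L (delta_mx j 0).
have [L2 L2P] := IHI L1; exists L2 => x t; rewrite -L2P; split.
  move=> [z z0 Lz]; exists (z - z j 0 *: delta_mx j 0).
    move=> i iI; rewrite !mxE eqxx andbT.
    have [->|ij] := eqVneq i j; first by rewrite mulr1 subrr.
    by rewrite mulr0 subr0 z0// inE negb_or ij.
  by rewrite -L1P; exists (z j 0); rewrite addrA subrK.
move=> [z z0 /L1P[y Ly]]; exists (z + y *: delta_mx j 0); last by rewrite addrA.
by move=> i; rewrite inE negb_or !mxE => /andP[/negPf-> /z0->]; rewrite mulr0 addr0.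
Qed.

(** Eliminating all of [x] leaves finitely many inequalities in [t] alone; the least upper bound
    among them is feasible, so the maximum is attained over any ordered field, in particular over
    the rationals. *)
Lemma parameter_max L : (exists x t, feasible L x t) ->
  (exists M, forall x t, feasible L x t -> t <= M) ->
  exists x t, feasible L x t /\ forall x' t', feasible L x' t' -> t' <= t.
Proof.
move=> [x0 [t0 L0]] [M LM].
have [L' L'P] := eliminate_coordinates (enum 'I_n) L.
have LL' t : (exists x, feasible L x t) <-> feasible L' 0 t.
  rewrite -L'P; split=> -[x]; last by rewrite add0r; exists x.
  by exists x; rewrite ?add0r// => i; rewrite mem_enum.
have slackE p t : slack p 0 t = p.1.2 + p.2 * t.
  by rewrite /slack mulmx0 mxE subr0.
have /allP L't0 : feasible L' 0 t0 by rewrite -LL'; exists x0.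
pose up := [seq p <- L' | p.2 < 0].
have [up0|upN0] := eqVneq up [::].
  (* If nothing bounds [t] above, raising [t] from [t0] keeps feasibility and passes [M]. *)
  have [x Lx] : exists x, feasible L x (Num.max t0 M + 1).
    apply/LL'/allP=> p pL'; have := L't0 p pL'; rewrite !slackE.
    have : p.2 >= 0.
      rewrite leNgt; apply/negP=> p2.
      have : p \in up by rewrite mem_filter p2.
      by rewrite up0.
    have : t0 <= Num.max t0 M by rewrite le_max lexx.
    by nra.
  have := LM _ _ Lx; have : M <= Num.max t0 M by rewrite le_max lexx orbT.
  by lra.
have [q qup qmin] := seq_minimizer (fun p => - p.1.2 / p.2) upN0.
have up_le p t : p.2 < 0 -> (0 <= slack p 0 t) = (t <= - p.1.2 / p.2).
  by move=> p2; rewrite slackE ler_ndivlMr//; apply/idP/idP; lra.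
have [q2 qL'] : q.2 < 0 /\ q \in L' by move: qup; rewrite mem_filter => /andP[].
(* Inequalities with nonnegative coefficient of [t] hold at [t0], hence also at this larger
   value. *)
have [x Lx] : exists x, feasible L x (- q.1.2 / q.2).
  apply/LL'/allP=> p pL'; have [p2|p2] := ltP p.2 0.
    by rewrite up_le// qmin// mem_filter p2.
  have := L't0 p pL'; have := L't0 q qL'; rewrite up_le// !slackE.
  by nra.
exists x, (- q.1.2 / q.2); split=> // x' t' L't'.
have /allP/(_ q qL') : feasible L' 0 t' by rewrite -LL'; exists x'.
by rewrite up_le.
Qed.

End FourierMotzkin.

(** * Maximising a ratio of piecewise linear functions over rational vectors *)

Lemma norm1_ge0 {n} (c : 'cV[rat]_n) : 0 <= norm1 c.
Proof. exact: sumr_ge0. Qed.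

Lemma norm1_gt0 {n} (c : 'cV[rat]_n) : (0 < norm1 c) = (c != 0).
Proof.
rewrite lt0r norm1_ge0 andbT; congr (~~ _); apply/idP/eqP => [|->].
  rewrite psumr_eq0// => /allP c0; apply/colP=> i.
  by have := c0 i (mem_index_enum i); rewrite normr_eq0 mxE => /eqP.
by rewrite /norm1 big1// => i _; rewrite mxE normr0.
Qed.

Lemma norm1Z {n} (a : rat) (c : 'cV[rat]_n) : norm1 (a *: c) = `|a| * norm1 c.
Proof. by rewrite mulr_sumr; apply: eq_bigr => i _; rewrite mxE normrM. Qed.

Lemma mul_le_norm1 {n} (f : 'rV[rat]_n) (c : 'cV[rat]_n) :
  (f *m c) 0 0 <= (\sum_j `|f 0 j|) * norm1 c.
Proof.
rewrite mxE mulr_suml ler_sum// => i _.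
rewrite (le_trans (ler_norm _))// normrM ler_wpM2l//.
by rewrite /norm1 (bigD1 i)//= lerDl sumr_ge0.
Qed.

Definition sign_row {n} (s : {ffun 'I_n -> bool}) : 'rV[rat]_n :=
  \row_i (-1) ^+ s i.

(** The unit ball is a cross-polytope, cut out by one linear inequality per sign pattern; the
    pattern of the signs of [c] gives the norm itself. *)
Lemma norm1_le1 {n} (c : 'cV[rat]_n) :
  (norm1 c <= 1) = [forall s : {ffun 'I_n -> bool}, (sign_row s *m c) 0 0 <= 1].
Proof.
apply/idP/forallP=> [c1 s|].
  apply: le_trans c1; rewrite mxE ler_sum// => i _; rewrite mxE.
  by rewrite (le_trans (ler_norm _))// normrM normrX normrN1 expr1n mul1r.
move=> /(_ [ffun i => c i 0 < 0]); apply: le_trans.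
by rewrite mxE ler_sum// => i _; rewrite mxE ffunE mulr_sign normrEsign mulr_sign.
Qed.

(** A linear program in [(c, t)]: maximise [t] subject to [t <= f *m c] for [f] in [k], with [c] in
    the unit ball. Any single [f] bounds [t]. *)
Lemma max_min_attained {n} (k : seq 'rV[rat]_n) : k != [::] ->
  exists c t, [/\ norm1 c <= 1, {in k, forall f, t <= (f *m c) 0 0} &
    forall c' t', norm1 c' <= 1 -> {in k, forall f, t' <= (f *m c') 0 0} ->
      t' <= t].
Proof.
move=> k0.
pose L : seq ('rV[rat]_n * rat * rat) := [seq (- f, 0, -1) | f <- k] ++
  [seq (sign_row s, 1, 0) | s : {ffun 'I_n -> bool}].
have LP c t : feasible L c t <->
    norm1 c <= 1 /\ {in k, forall f, t <= (f *m c) 0 0}.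
  rewrite /feasible all_cat norm1_le1; split.
    move=> /andP[/allP Lk /allP Ls]; split.
      apply/forallP=> s.
      have := Ls _ (map_f (fun s => (sign_row s, 1, 0)) (mem_enum _ s)).
      by rewrite /slack/= mul0r addr0 subr_ge0.
    move=> f /(map_f (fun f => (- f, 0, -1)))/Lk.
    by rewrite /slack/= mulNmx mxE; lra.
  move=> [/forallP Ls Lk]; apply/andP; split; apply/allP=> p /mapP[].
    move=> f /Lk ft ->; rewrite /slack/= mulNmx mxE; lra.
  by move=> s _ ->; rewrite /slack/= mul0r addr0 subr_ge0.
have [||c [t [/LP[c1 ct] tmax]]] := @parameter_max _ _ L.
- exists 0, 0; apply/LP; split; first by rewrite /norm1 big1// => i _; rewrite mxE normr0.
  by move=> f _; rewrite mulmx0 mxE.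
- have [f fk _] := seq_minimizer (fun=> 0 : rat) k0.
  exists (\sum_j `|f 0 j|) => c t /LP[c1] /(_ f fk)/le_trans; apply.
  by rewrite (le_trans (mul_le_norm1 _ _))// ler_piMr// sumr_ge0.
by exists c, t; split=> // c' t' c'1 c't'; apply: (tmax c'); apply/LP.
Qed.

(** The two hypotheses relating [g] to [K] say that [g] is a maximum over [K] of minima of linear
    forms. By homogeneity the ratio is controlled by the optima over the unit ball, and the best [k]
    is chosen among finitely many. *)
Lemma max_ratio_attained {R : realType} {n} (K : seq (seq 'rV[rat]_n))
    (g : 'cV[rat]_n -> R) :
  (0 < n)%N -> (forall c, 0 <= g c) ->
  (forall c, exists2 k, k \in K & {in k, forall f, g c <= ratr ((f *m c) 0 0)}) ->
  (forall c, {in K, forall k, exists2 f, f \in k & ratr ((f *m c) 0 0) <= g c}) ->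
  exists2 c, c != 0 & forall c', c' != 0 ->
    g c' / ratr (norm1 c') <= g c / ratr (norm1 c).
Proof.
move=> n0 g0 gle gge.
have KN0 k : k \in K -> k != [::] by move=> /(gge 0)[f]; case: k.
have /choice[h hP] (k : seq 'rV[rat]_n) : exists p : 'cV[rat]_n * rat, k != [::] ->
  [/\ norm1 p.1 <= 1, {in k, forall f, p.2 <= (f *m p.1) 0 0} &
    forall c' t', norm1 c' <= 1 -> {in k, forall f, t' <= (f *m c') 0 0} ->
      t' <= p.2].
  have [->|/max_min_attained[c [t P]]] := eqVneq k [::]; first by exists (0, 0).
  by exists (c, t).
have KN : K != [::] by have [k] := gle 0; case: (K).
have [k kK kmax] := seq_minimizer (fun k => - (h k).2) KN.
have [h1 hk _] := hP k (KN0 k kK).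
have g_le c : c != 0 -> g c / ratr (norm1 c) <= ratr (h k).2.
  rewrite -norm1_gt0 => c0; have [j jK jle] := gle c.
  have [f fj fmin] := seq_minimizer (fun f => (f *m c) 0 0) (KN0 j jK).
  rewrite ler_pdivrMr ?ltr0q// -rmorphM (le_trans (jle f fj))// ler_rat.
  rewrite -ler_pdivrMr// (@le_trans _ _ (h j).2)//; last first.
    by rewrite -lerN2 kmax.
  have [_ _ /(_ ((norm1 c)^-1 *: c))] := hP j (KN0 j jK); apply.
    by rewrite norm1Z gtr0_norm ?invr_gt0// mulVf// gt_eqF.
  move=> e ej; rewrite -scalemxAr [X in _ <= X]mxE mulrC.
  by rewrite ler_pM2l ?invr_gt0// fmin.
(* A positive optimum forces a nonzero maximiser, and dividing by its norm, at most 1, does not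
   decrease the value. Otherwise [g >= 0] makes every ratio 0, and any nonzero vector will do. *)
have [hk0|hk0] := ltP 0 (h k).2.
  have hk1 : (h k).1 != 0.
    apply: contraTneq hk0 => h0; rewrite -leNgt.
    have [f fk _] := gge 0 k kK.
    by have := hk f fk; rewrite h0 mulmx0 mxE.
  exists (h k).1 => // c /g_le/le_trans; apply.
  rewrite ler_pdivlMr ?ltr0q ?norm1_gt0//.
  have [f fk] := gge (h k).1 k kK; apply: le_trans.
  rewrite -rmorphM ler_rat (le_trans _ (hk f fk))//.
  by rewrite ler_piMr// ltW.
have c1N0 : const_mx 1 != 0 :> 'cV[rat]_n.
  by apply/negP=> /eqP/colP/(_ (Ordinal n0)); rewrite !mxE.
exists (const_mx 1) => // c /g_le/le_trans; apply.
rewrite (@le_trans _ _ 0) ?lerq0//.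
by rewrite divr_ge0 ?ler0q ?norm1_ge0.
Qed.

(** * The gap as a function of the cost vector *)

Lemma set_minE {R : realType} {S : set R} {m : R} :
  S m -> lbound S m -> set_min S = m.
Proof.
move=> Sm mS; apply: xget_unique => // y [Sy yS].
by apply/eqP; rewrite eq_le yS// mS.
Qed.

Lemma set_maxE {R : realType} {S : set R} {m : R} :
  S m -> ubound S m -> set_max S = m.
Proof.
move=> Sm Sm'; apply: xget_unique => // y [Sy Sy'].
by apply/eqP; rewrite eq_le Sm'// Sy'.
Qed.

Lemma finite_bounded_mx {p q : nat} (k : nat) :
  finite_set [set M : 'M[int]_(p, q) | forall i j, 0 <= M i j <= k%:Z].
Proof.
pose f (g : {ffun 'I_p * 'I_q -> 'I_k.+1}) : 'M[int]_(p, q) :=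
  \matrix_(i, j) (g (i, j))%:Z.
apply: (@sub_finite_set _ _ [set f g | g in setT]); last first.
  exact/finite_image/finite_finset.
move=> M Mk; exists [ffun ij => inord `|M ij.1 ij.2|%N] => //.
apply/matrixP=> i j; rewrite mxE ffunE /=.
have /andP[M0 Mij] := Mk i j; rewrite inordK; last by rewrite ltnS -lez_nat gez0_abs.
by rewrite gez0_abs.
Qed.

Section Gap.
Set Implicit Arguments.
Unset Strict Implicit.
Context {R : realType} {n : nat}.
Implicit Types (A : 'rV[int]_n) (b : int) (c : 'cV[rat]_n) (x : 'cV[int]_n).

Definition solutions A b : set 'cV[int]_n :=
  [set x | A *m x = b%:M /\ forall i, 0 <= x i 0].

Lemma mul_row_colE (S : pzRingType) (u : 'rV[S]_n) (v : 'cV[S]_n) (a : S) :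
  u *m v = a%:M <-> \sum_i u 0 i * v i 0 = a.
Proof.
split=> [/matrixP/(_ 0 0)|<-]; first by rewrite !mxE mulr1n.
by apply/matrixP=> i j; rewrite !ord1 !mxE mulr1n.
Qed.

Lemma dotE c x : dot c (map_mx intr x) = ratr (\sum_i c i 0 * (x i 0)%:~R) :> R.
Proof.
by rewrite rmorph_sum; apply: eq_bigr => i _; rewrite rmorphM/= ratr_int mxE.
Qed.

(* Excess of the objective at [x] over the relaxed solution supported on
   coordinate [i], which is optimal when [i] minimises [c_i / a_i]. *)
Definition excess A b (i : 'I_n) x : 'rV[rat]_n :=
  \row_j (x j 0)%:~R - (b%:~R / (A 0 i)%:~R) *: delta_mx 0 i.

Lemma excessE A b i x c : (excess A b i x *m c) 0 0 =
  \sum_j c j 0 * (x j 0)%:~R - c i 0 * (b%:~R / (A 0 i)%:~R).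
Proof.
rewrite mulmxBl mxE; congr (_ + _).
  by rewrite mxE; apply: eq_bigr => j _; rewrite mxE mulrC.
by rewrite mxE -scalemxAl -rowE !mxE mulrC.
Qed.

Context (A : 'rV[int]_n) (A_gt0 : forall i, 0 < A 0 i).

Lemma solutions_ge0 b x : solutions A b x -> 0 <= b.
Proof.
move=> [/mul_row_colE <- x0]; apply: sumr_ge0 => i _.
by rewrite mulr_ge0// ltW.
Qed.

Lemma solutions_le b x i : solutions A b x -> x i 0 <= b.
Proof.
move=> [/mul_row_colE <- x0]; rewrite (bigD1 i)//= (@le_trans _ _ (A 0 i * x i 0))//.
  by rewrite ler_peMl// -gtz0_ge1.
by rewrite lerDl sumr_ge0// => j _; rewrite mulr_ge0// ltW.
Qed.

Lemma solutions_finite b : finite_set (solutions A b).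
Proof.
apply: (sub_finite_set _ (finite_bounded_mx `|b|%N)) => x bx i j.
rewrite !ord1; have [_ ->] := bx; have := solutions_le i bx.
by have := solutions_ge0 bx; lia.
Qed.

Lemma IP_attained c b : solutions A b !=set0 -> exists2 x, solutions A b x &
  IP R c A b = ratr (\sum_i c i 0 * (x i 0)%:~R) /\
  forall y, solutions A b y ->
    \sum_i c i 0 * (x i 0)%:~R <= \sum_i c i 0 * (y i 0)%:~R.
Proof.
have /finite_seqP[s sE] := solutions_finite b; move=> [x0]; rewrite sE => x0s.
have [|x xs xmin] := seq_minimizer (fun x => \sum_i c i 0 * (x i 0)%:~R) (s := s).
  by apply: contraTneq x0s => ->.
exists x => //; split=> //; apply: set_minE.
  by exists x; [rewrite -/(solutions A b) sE|rewrite dotE].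
by move=> v [y]; rewrite -/(solutions A b) sE => ys <-; rewrite dotE ler_rat xmin.
Qed.

(** Weak duality: the least ratio [c_i / a_i] times [A x = b] bounds the cost below, and putting all
    weight on coordinate [i] attains this. *)
Lemma LP_eq c b i : 0 <= b ->
  (forall j, c i 0 / (A 0 i)%:~R <= c j 0 / (A 0 j)%:~R) ->
  LP R c A b = ratr (c i 0 * (b%:~R / (A 0 i)%:~R)).
Proof.
move=> b0 imin; have AR j : (A 0 j)%:~R > 0 :> R by rewrite ltr0z.
apply: set_minE.
  exists ((b%:~R / (A 0 i)%:~R) *: delta_mx i 0).
    split=> [|j]; last by rewrite !mxE eqxx mulr_ge0// divr_ge0 ?ler0z// ltW.
    apply/mul_row_colE; rewrite (bigD1 i)//= big1 ?addr0.
      by rewrite !mxE !eqxx mulr1 mulrC divfK// gt_eqF.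
    by move=> j ji; rewrite !mxE (negPf ji) mulr0 mulr0.
  rewrite /dot (bigD1 i)//= big1 ?addr0.
    by rewrite !mxE !eqxx mulr1 rmorphM/= fmorph_div/= !ratr_int.
  by move=> j ji; rewrite !mxE (negPf ji) mulr0 mulr0.
move=> _ [x [/mul_row_colE Ax x0] <-].
rewrite rmorphM/= fmorph_div/= !ratr_int -Ax mulrCA.
rewrite mulr_suml ler_sum// => j _.
rewrite mxE; have := imin j; rewrite -(ler_rat R) !fmorph_div/= !ratr_int.
rewrite ler_pdivlMr// => h.
by have := ler_wpM2r (x0 j) h; apply: le_trans; rewrite mulrC mulrA.
Qed.

Lemma has_inf_IP_values c b :
  has_inf (IP_values c A b : set R) <-> solutions A b !=set0.
Proof.
split=> [[[_ [x xb _]] _]|bN0]; first by exists x.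
have [x xb [_ xmin]] := IP_attained c bN0.
split; first by exists (dot c (map_mx intr x)), x.
exists (ratr (\sum_i c i 0 * (x i 0)%:~R)) => v [y yb <-].
by rewrite dotE ler_rat xmin.
Qed.

Context (n_gt0 : (0 < n)%N).

Lemma ratio_minimizer c :
  exists i, forall j, c i 0 / (A 0 i)%:~R <= c j 0 / (A 0 j)%:~R.
Proof.
have [|i _ imin] := seq_minimizer (fun i => c i 0 / (A 0 i)%:~R) (s := enum 'I_n).
  by rewrite -size_eq0 size_enum_ord -lt0n.
by exists i => j; apply: imin; rewrite mem_enum.
Qed.

(** The index of least ratio depends on [c] only, hence the order of quantifiers. With
    [excess_le_IG], the integrality gap becomes a maximum over [i] of minima over [x] of linear
    forms in [c]. *)
Lemma IG_le_excess c : exists i, forall b x, solutions A b x ->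
  IG R c A b <= ratr ((excess A b i x *m c) 0 0).
Proof.
have [i imin] := ratio_minimizer c; exists i => b x xb.
have [y yb [IPE ymin]] := IP_attained c (ex_intro _ x xb).
rewrite /IG IPE (LP_eq (solutions_ge0 xb) imin) excessE -rmorphB ler_rat.
by rewrite lerB// ymin.
Qed.

(** For arbitrary [i], the point supported on coordinate [i] is feasible for the relaxation, so its
    cost is at least the relaxed optimum. *)
Lemma excess_le_IG c b i : solutions A b !=set0 ->
  exists2 x, solutions A b x & ratr ((excess A b i x *m c) 0 0) <= IG R c A b.
Proof.
move=> bN0; have [x xb [IPE xmin]] := IP_attained c bN0; exists x => //.
have [j jmin] := ratio_minimizer c.
rewrite /IG IPE (LP_eq (solutions_ge0 xb) jmin) excessE -rmorphB ler_rat lerB//.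
rewrite mulrCA [leRHS]mulrCA ler_wpM2l// ler0z.
exact: solutions_ge0 xb.
Qed.

(* If [x j] is at least [a_i], then [a_i] units of [x j] can be traded for
   [a_j] units of [x i]. *)
Lemma solutions_subr b x i j : solutions A b x -> A 0 i <= x j 0 ->
  solutions A (b - A 0 i) !=set0.
Proof.
move=> [/mul_row_colE xb x0] ij.
(* The [- 1] removes one unit of [x i] after the trade, lowering the right-hand side by [a_i]. *)
exists (x - A 0 i *: delta_mx j 0 + (A 0 j - 1) *: delta_mx i 0); split.
  apply/mul_row_colE; rewrite -xb.
  transitivity (\sum_k (A 0 k * x k 0 - A 0 i * (A 0 k * (k == j)%:R) +
      (A 0 j - 1) * (A 0 k * (k == i)%:R))).
    by apply: eq_bigr => k _; rewrite !mxE !andbT; ring.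
  rewrite big_split/= sumrB -!mulr_sumr.
  have pick l : \sum_k A 0 k * (k == l)%:R = A 0 l.
    rewrite (bigD1 l)//= eqxx mulr1 big1 ?addr0// => k /negPf->.
    by rewrite mulr0.
  by rewrite !pick; ring.
move=> k; rewrite !mxE !andbT; have := A_gt0 i; have := A_gt0 j.
have := x0 k.
by case: (eqVneq k j) => [kj|_]; case: (eqVneq k i) => [ki|_] /=; subst; lia.
Qed.

(** A crude bound serving every [i]: if all coordinates of a solution are below [a_i], then [b] is
    at most [a_i] times the sum of the entries. *)
Definition rhs_bound : int := (\sum_i A 0 i) ^+ 2.

Lemma exists_large_coordinate b x i : solutions A b x -> rhs_bound < b ->
  exists j, A 0 i <= x j 0.
Proof.
move=> [/mul_row_colE xb x0] bb; apply: contrapT => /forallNP xi.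
suff : b <= rhs_bound by rewrite leNgt bb.
rewrite -xb /rhs_bound expr2 mulr_suml ler_sum// => j _.
rewrite ler_wpM2l ?(ltW (A_gt0 _))// (@le_trans _ _ (A 0 i))//.
  by rewrite ltW// ltNge; apply/negP/xi.
by rewrite (bigD1 i)//= lerDl sumr_ge0// => k _; rewrite ltW.
Qed.

(** For the [i] of least ratio, passing from [b - a_i] to [b] raises the relaxed value by exactly
    [c_i] and the integer value by at most [c_i]. So subtracting [a_i] does not decrease the gap,
    and this descent ends below [rhs_bound]. *)
Lemma IG_le_bounded_rhs c b : solutions A b !=set0 ->
  exists b', [/\ solutions A b' !=set0, b' <= rhs_bound &
    IG R c A b <= IG R c A b'].
Proof.
have [i IGi] := IG_le_excess c.
have [k] := ubnP `|b|%N; elim: k b => // k IHk b bk bN0.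
have [bb|bb] := leP b rhs_bound; first by exists b.
have [x xb] := bN0; have [j xj] := exists_large_coordinate i xb bb.
have baN0 := solutions_subr xb xj.
have [y yb yle] := excess_le_IG c i baN0.
have [|b' [b'N0 b'b IGb']] := IHk (b - A 0 i) _ baN0.
  by have := solutions_ge0 yb; have := A_gt0 i; lia.
exists b'; split=> //; apply: le_trans IGb'; apply: le_trans yle.
have yib : solutions A b (y + delta_mx i 0).
  have [/mul_row_colE yb1 y0] := yb; split; last first.
    by move=> l; rewrite !mxE addr_ge0.
  apply/mul_row_colE; rewrite -[b](subrK (A 0 i)) -yb1.
  under eq_bigr do rewrite !mxE andbT mulrDr.
  rewrite big_split/=; congr (_ + _); rewrite (bigD1 i)//= eqxx mulr1.
  by rewrite big1 ?addr0// => l /negPf->; rewrite mulr0.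
apply: le_trans (IGi _ _ yib) _; rewrite ler_rat !excessE.
under eq_bigr do rewrite !mxE andbT rmorphD/= mulrDr.
have pick : \sum_l c l 0 * (l == i)%:R%:~R = c i 0.
  rewrite (bigD1 i)//= eqxx mulr1 big1 ?addr0// => l /negPf->.
  by rewrite mulr0.
rewrite big_split/= pick.
by rewrite rmorphB/= mulrBl divff ?gt_eqF ?ltr0z//; lra.
Qed.

Definition bounded_rhs : seq int :=
  [seq b <- [seq Posz k | k <- iota 0 `|rhs_bound|.+1] | `[< solutions A b !=set0 >]].

Lemma bounded_rhsP b :
  reflect (solutions A b !=set0 /\ b <= rhs_bound) (b \in bounded_rhs).
Proof.
have rhs0 : 0 <= rhs_bound by rewrite sqr_ge0.
rewrite mem_filter; apply: (iffP andP) => -[].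
  move=> /asboolP bN0 /mapP[k]; rewrite mem_iota => kb bk; split=> //.
  by rewrite bk; lia.
move=> bN0 bb; split; first exact/asboolP.
apply/mapP; exists `|b|%N; last by have [x /solutions_ge0] := bN0; lia.
by rewrite mem_iota; have [x /solutions_ge0] := bN0; lia.
Qed.

Lemma solutions0 : solutions A 0 0.
Proof.
split=> [|i]; last by rewrite mxE.
by apply/mul_row_colE; rewrite big1// => i _; rewrite mxE mulr0.
Qed.

Lemma Gap_attained c : exists2 b, b \in bounded_rhs & Gap R c A = IG R c A b /\
  forall b', solutions A b' !=set0 -> IG R c A b' <= Gap R c A.
Proof.
have B0 : 0 \in bounded_rhs.
  by apply/bounded_rhsP; split; [exists 0; exact: solutions0|exact: sqr_ge0].
have [|b bB bmax] := seq_minimizer (fun b => - IG R c A b) (s := bounded_rhs).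
  by apply: contraTneq B0 => ->.
have ub b' : solutions A b' !=set0 -> IG R c A b' <= IG R c A b.
  move=> /(IG_le_bounded_rhs c)[b'' [b''N0 b''b /le_trans]]; apply.
  by rewrite -lerN2 bmax//; apply/bounded_rhsP.
have GapE : Gap R c A = IG R c A b.
  apply: set_maxE.
    by exists b => //; apply/has_inf_IP_values; case/bounded_rhsP: bB.
  by move=> v [b' /has_inf_IP_values b'N0 <-]; exact: ub.
by exists b => //; rewrite GapE.
Qed.

Lemma IG_le_Gap c b : solutions A b !=set0 -> IG R c A b <= Gap R c A.
Proof. by have [b' _ [_]] := Gap_attained c; apply. Qed.

(** The right-hand side 0 has only the zero solution, whose excess vanishes. *)
Lemma Gap_ge0 c : 0 <= Gap R c A.
Proof.
have A0 : solutions A 0 !=set0 by exists 0; exact: solutions0.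
have [x x0] := excess_le_IG c (Ordinal n_gt0) A0.
move=> /le_trans/(_ (IG_le_Gap c A0)); apply: le_trans.
rewrite excessE mul0r mulr0 subr0 big1 ?rmorph0// => j _.
have [_ /(_ j) xj] := x0; have := solutions_le j x0 => xj0.
by rewrite (_ : x j 0 = 0) ?mulr0//; apply/eqP; rewrite eq_le xj xj0.
Qed.

Lemma max_gap_ratio_attained : exists2 c, c != 0 & forall c', c' != 0 ->
  Gap R c' A / ratr (norm1 c') <= Gap R c A / ratr (norm1 c).
Proof.
pose sols b := finmap.enum_fset (fset_set (solutions A b)).
have solsP b x : x \in sols b <-> solutions A b x.
  have := in_fset_set (solutions_finite b) x; rewrite /sols => ->.
  by rewrite inE.
apply: (max_ratio_attained
  [seq [seq excess A b i x | x <- sols b] | b <- bounded_rhs, i <- enum 'I_n]) => //.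
- exact: Gap_ge0.
- move=> c; have [b bB [GapE _]] := Gap_attained c; have [i IGi] := IG_le_excess c.
  exists [seq excess A b i x | x <- sols b].
    by apply: allpairs_f; rewrite ?mem_enum.
  by move=> f /mapP[x /solsP xb ->]; rewrite GapE IGi.
- move=> c k /allpairsP[[b i] [/bounded_rhsP[bN0 _] _ ->]] /=.
  have [x xb xle] := excess_le_IG c i bN0.
  exists (excess A b i x); first by apply/map_f/solsP.
  exact: le_trans xle (IG_le_Gap c bN0).
Qed.

(** Attainment rules out the default value of [set_max], so one cost vector suffices for a lower
    bound. The power of [mx_norm A] is a constant factor in [c]. *)
Lemma le_max_gap_ratio c : c != 0 ->
  Gap R c A / (((mx_norm A)%:~R `^ (n%:R - 1)^-1) * ratr (norm1 c))
    <= max_gap_ratio R A.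
Proof.
move=> cN0; have [c' c'N0 c'max] := max_gap_ratio_attained.
set D := _ `^ _; have ratioE c1 : Gap R c1 A / (D * ratr (norm1 c1)) =
  D^-1 * (Gap R c1 A / ratr (norm1 c1)) by rewrite invfM mulrCA.
have D0 : 0 <= D^-1 by rewrite invr_ge0 powR_ge0.
rewrite /max_gap_ratio (@set_maxE _ _ (Gap R c' A / (D * ratr (norm1 c')))).
- by rewrite !ratioE ler_wpM2l// c'max.
- by exists c'.
- by move=> v [c1 c1N0 <-]; rewrite -/D !ratioE ler_wpM2l// c'max.
Qed.

End Gap.

(** * The lower bound *)

Lemma bigop_bezout {n} (a : 'I_n -> int) :
  exists y, \sum_i a i * y i = \big[gcdz/0]_i a i.
Proof.
apply: (big_ind (fun g => exists y, \sum_i a i * y i = g)).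
- by exists (fun=> 0); rewrite big1// => i _; rewrite mulr0.
- move=> _ _ [y <-] [z <-].
  have [u [v <-]] := Bezoutz (\sum_i a i * y i) (\sum_i a i * z i).
  exists (fun i => u * y i + v * z i).
  rewrite !mulr_sumr -big_split/=; apply: eq_bigr => i _; ring.
- move=> i _; exists (fun j => (j == i)%:R).
  rewrite (bigD1 i)//= eqxx mulr1 big1 ?addr0// => j /negPf->.
  by rewrite mulr0.
Qed.

Section GapLowerBound.
Set Implicit Arguments.
Unset Strict Implicit.
Context {R : realType} {n : nat} (A : 'rV[int]_n).
Context (A_gt0 : forall i, 0 < A 0 i).
Context (A_coprime : \big[gcdz/0]_(i < n) A 0 i = 1).

(** Bezout coefficients times [r] give an integer solution; reducing them modulo [a_i] makes them
    nonnegative and keeps the residue of the right-hand side. *)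
Lemma solvable_residue (i : 'I_n) (r : int) : exists b,
  (b = r %[mod (A 0 i)%R])%Z /\ solutions A b !=set0.
Proof.
have [y] := bigop_bezout (fun i => A 0 i); rewrite A_coprime => y1.
pose x : 'cV[int]_n := \col_j (y j * r %% (A 0 i)%R)%Z.
exists (\sum_j A 0 j * x j 0); split.
  rewrite -[r in RHS]mul1r -y1 mulr_suml.
  apply: (big_ind2 (fun s t => s = t %[mod (A 0 i)%R])%Z) => //.
    by move=> s1 t1 s2 t2 e1 e2; rewrite -modzDm e1 e2 modzDm.
  by move=> j _; rewrite mxE modzMmr mulrA.
exists x; split=> [|j]; first exact/mul_row_colE.
by rewrite mxE modz_ge0// gt_eqF.
Qed.

(* Fewer than [a_i] residues modulo [a_i] are hit by points whose coordinates
   other than the [i]-th are smaller than [u]. *)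
Lemma avoided_residue (i : 'I_n) (u : nat) : (u ^ n.-1)%:Z < A 0 i ->
  exists r, forall b x, (b = r %[mod (A 0 i)%R])%Z -> solutions A b x ->
    exists2 j, j != i & u%:Z <= x j 0.
Proof.
move=> uA.
pose hit := [seq ((\sum_k A 0 (lift i k) * (g k)%:Z)%R %% (A 0 i)%R)%Z |
  g : {ffun 'I_n.-1 -> 'I_u}].
pose residues := [seq r%:Z | r <- iota 0 `|A 0%R i|].
have [r rres rhit] : exists2 r, r \in residues & r \notin hit.
  apply/allPn/negP => /allP/uniq_leq_size.
  rewrite map_inj_uniq ?iota_uniq; last by move=> ? ? [].
  move=> /(_ isT); rewrite size_map size_iota size_image card_ffun !card_ord.
  by have := A_gt0 i; lia.
exists r => b x br [/mul_row_colE xb x0]; apply: contrapT => small.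
have xu k : (`|x (lift i k) 0%R| < u)%N.
  rewrite ltnNge; apply/negP => ux; apply: small; exists (lift i k).
    by rewrite eq_sym neq_lift.
  by rewrite -(gez0_abs (x0 _)) lez_nat.
move/negP: rhit; apply; apply/mapP.
exists [ffun k => Ordinal (xu k)]; first by rewrite mem_enum.
have -> : r = (b %% (A 0 i)%R)%Z.
  move: rres => /mapP[m]; rewrite mem_iota => mA rm.
  by rewrite br modz_small// rm; lia.
rewrite -xb (bigD1_ord i)//= mulrC modzMDl; congr (_ %% _)%Z.
by apply: eq_bigr => k _; rewrite ffunE /= gez0_abs.
Qed.

Definition indicator_compl (i : 'I_n) : 'cV[rat]_n := \col_j (j != i)%:R.

Lemma norm1_indicator_compl i : norm1 (indicator_compl i) = n.-1%:R.
Proof.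
rewrite /norm1 (eq_bigr (fun j => if j != i then 1 else 0)); last first.
  by move=> j _; rewrite mxE; case: (j != i); rewrite ?normr1 ?normr0.
by rewrite -big_mkcond sumr_const cardC1 card_ord.
Qed.

(** As [c_i = 0], the excess for [i] is the plain cost, at least the coordinate [x j >= u] forced by
    the avoided residue. *)
Lemma Gap_indicator_compl_ge i u : (u ^ n.-1)%:Z < A 0 i ->
  u%:R <= Gap R (indicator_compl i) A.
Proof.
move=> uA; have n0 : (0 < n)%N by rewrite (leq_ltn_trans _ (ltn_ord i)).
have [r rP] := avoided_residue uA; have [b [br bN0]] := solvable_residue i r.
apply: le_trans (IG_le_Gap A_gt0 n0 (indicator_compl i) bN0).
have [x xb] := excess_le_IG (R := R) A_gt0 n0 (indicator_compl i) i bN0.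
apply: le_trans; have [j ji uj] := rP b x br xb.
rewrite -[u%:R]ratr_nat ler_rat excessE mxE eqxx mul0r subr0 (bigD1 j)//=.
rewrite mxE ji mul1r -[u%:R]/(u%:Z%:~R) -[leLHS]addr0 lerD ?ler_int// sumr_ge0// => k _.
by rewrite mxE mulr_ge0// ler0z; case: xb.
Qed.

Lemma max_gap_ratio_ge0 : (1 < n)%N -> 0 <= max_gap_ratio R A.
Proof.
move=> n1; have n0 : (0 < n)%N by exact: ltnW.
have c0 : indicator_compl (Ordinal n0) != 0.
  by rewrite -norm1_gt0 norm1_indicator_compl ltr0n -ltnS prednK.
apply: le_trans (le_max_gap_ratio (R := R) A_gt0 n0 c0).
by rewrite divr_ge0 ?Gap_ge0// mulr_ge0 ?powR_ge0// ler0q norm1_ge0.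
Qed.

Lemma max_gap_ratio_ge : (1 < n)%N -> 1 < mx_norm A ->
  (2 * (n%:R - 1))^-1 <= max_gap_ratio R A.
Proof.
move=> n1 M1; have n0 : (0 < n)%N by exact: ltnW.
have [[i0 i] /= MA] : exists i, mx_norm A = `|A i.1 i.2|.
  by apply: mx_norm_neq0; rewrite gt_eqF// (lt_trans _ M1).
move: MA; rewrite (ord1 i0) gtr0_norm// => {i0} MA.
have nR : n.-1%:R = n%:R - 1 :> R by rewrite -subn1 natrB.
have n1R : 0 < n%:R - 1 :> R by rewrite subr_gt0 ltr1n.
have c0 : indicator_compl i != 0.
  by rewrite -norm1_gt0 norm1_indicator_compl ltr0n -ltnS prednK.
apply: le_trans (le_max_gap_ratio (R := R) A_gt0 n0 c0).
(* The least such [v] is the ceiling of [M ^ (1 / (n - 1))], so [u = v - 1] satisfies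
   [u ^ (n - 1) < M]. *)
have v_ex : exists v, (`|A 0%R i| <= v ^ n.-1)%N.
  by exists `|A 0%R i|%N; rewrite -[leqLHS]expn1 leq_pexp2l; lia.
case: (ex_minnP v_ex) => v Av vmin.
have v2 : (1 < v)%N.
  rewrite ltnNge; apply/negP => v1; move: Av.
  rewrite leqNgt (@leq_ltn_trans (1 ^ n.-1)) ?leq_exp2r ?exp1n//; lia.
have uA : (v.-1 ^ n.-1)%:Z < A 0 i.
  rewrite ltNge; apply/negP => Au; have := vmin v.-1.
  by move: (A_gt0 i); lia.
rewrite MA norm1_indicator_compl ratr_nat nR ler_pdivlMr; last first.
  by rewrite mulr_gt0// powR_gt0// ltr0z.
apply: le_trans (Gap_indicator_compl_ge uA).
set D := _ `^ _; have -> : (2 * (n%:R - 1))^-1 * (D * (n%:R - 1)) = D / 2.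
  by field; rewrite gt_eqF.
(* Since [v >= 2], one has [D <= v <= 2 (v - 1)]. *)
rewrite ler_pdivrMr// (@le_trans _ _ v%:R)//; last first.
  by rewrite -natrM ler_nat; lia.
have -> : v%:R = (v%:R ^+ n.-1) `^ (n%:R - 1)^-1 :> R.
  by rewrite -powR_mulrn// -powRrM nR mulfV ?gt_eqF// powRr1.
apply: ge0_ler_powR; rewrite ?invr_ge0 ?(ltW n1R)// ?nnegrE ?exprn_ge0//.
  by rewrite ler0z ltW.
rewrite -natrX -[X in _ <= X]/((v ^ n.-1)%:Z%:~R) ler_int.
by move: (A_gt0 i); lia.
Qed.

End GapLowerBound.

(** * Averaging over [Q n T] *)

Lemma Q_finite {R : realType} (n : nat) (T : R) : finite_set (Q n T).
Proof.
apply: (sub_finite_set _ (finite_bounded_mx `|Num.floor T|%N)) => A [A0 _ AT] i j.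
rewrite (ord1 i) ltW//=.
have : A 0 j <= Num.floor T.
  rewrite floor_ge_int (le_trans _ AT)// ler_int mx_normrE.
  apply: le_trans (le_bigmax _ (fun ij => `|A ij.1 ij.2|) (ord0, j)).
  exact: ler_norm.
by move: (A0 j); lia.
Qed.

Lemma mem_Q {R : realType} {n : nat} (T : R) (A : 'rV[int]_n) :
  A \in fset_set (Q n T) <-> Q n T A.
Proof. by rewrite in_fset_set ?inE//; exact: Q_finite. Qed.

Lemma big_gcdz_eq1 {I : eqType} (s : seq I) (a : I -> int) (i : I) :
  i \in s -> a i = 1 -> \big[gcdz/0]_(j <- s) a j = 1.
Proof.
elim: s => // j s IHs; rewrite inE big_cons => /predU1P[<- ->|/IHs/[apply]->].
  exact: gcd1z.
exact: gcdz1.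
Qed.

Lemma Q_of_le2 {R : realType} {n : nat} (T : R) (A : 'rV[int]_n) (i : 'I_n) :
  2 <= T -> A 0 i = 1 -> (forall j, 0 < A 0 j <= 2) -> Q n T A.
Proof.
move=> T2 Ai A12; split.
- by move=> j; case/andP: (A12 j).
- by apply: big_gcdz_eq1 Ai; rewrite mem_index_enum.
apply: le_trans T2; rewrite -[leRHS]/(2%:Z%:~R) ler_int mx_normrE.
apply: bigmax_le => // -[i0 j] _ /=; rewrite (ord1 i0).
by case/andP: (A12 j) => A0; rewrite gtr0_norm.
Qed.

Lemma mx_norm_gt1 {n : nat} (A : 'rV[int]_n) :
  (forall i, 0 < A 0 i) -> A != const_mx 1 -> 1 < mx_norm A.
Proof.
move=> A_gt0; apply: contraNT; rewrite -leNgt mx_normrE => M1.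
apply/eqP/rowP => i; rewrite mxE; apply/eqP; rewrite eq_le -gtz0_ge1 A_gt0 andbT.
apply: le_trans M1.
apply: le_trans (le_bigmax _ (fun ij => `|A ij.1 ij.2|) (ord0, i)).
exact: ler_norm.
Qed.

Theorem theorem5 (R : realType) (n : nat) (hn : (2 <= n)%N) :
  exists kappa T0 : R,
    [/\ 0 < kappa, 1 <= T0 &
      forall T : R, T0 <= T ->
        kappa <= (N n T)%:R^-1 * \sum_(A \in Q n T) max_gap_ratio R A].
Proof.
pose kappa : R := (2 * (n%:R - 1))^-1.
have kappa_gt0 : 0 < kappa by rewrite invr_gt0 mulr_gt0// subr_gt0 ltr1n.
(* The all-ones vector contributes only a nonnegative term. For [T >= 2] it is at most half of
   [Q n T], which costs the factor 2. *)
exists (kappa / 2), 2; split; rewrite ?divr_gt0 ?ler1n// => T T2.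
have Qfin := Q_finite n T.
rewrite fsbig_finite//= /N; set S := enum_fset (fset_set (Q n T)).
have SP A : A \in S <-> Q n T A := mem_Q T A.
have uS : uniq S := fset_uniq _.
pose ones : 'rV[int]_n := const_mx 1.
pose i0 : 'I_n := Ordinal (ltnW hn); pose i1 : 'I_n := Ordinal hn.
(* A second member of [Q n T]; its entry 1 at [i1] makes the gcd 1. *)
pose A2 : 'rV[int]_n := \row_j (if j == i0 then 2 else 1).
have onesS : ones \in S.
  by apply/SP; apply: (@Q_of_le2 _ _ _ _ i0) => // [|j]; rewrite mxE.
have A2S : A2 \in S.
  apply/SP; apply: (@Q_of_le2 _ _ _ _ i1) => // [|j]; rewrite mxE//.
  by case: (j == i0).
have S2 : (2 <= size S)%N.
  apply: (@uniq_leq_size _ [:: ones; A2]).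
    rewrite /= inE andbT; apply/eqP => /rowP/(_ i0).
    by rewrite !mxE eqxx.
  by move=> A; rewrite !inE => /orP[]/eqP->.
rewrite [leRHS]mulrC ler_pdivlMr ?ltr0n ?(leq_trans _ S2)//.
rewrite (bigD1_seq ones)//= -[leLHS]add0r lerD//.
  by apply: max_gap_ratio_ge0 => // i; rewrite mxE.
rewrite big_seq_cond.
apply: (@le_trans _ _ (\sum_(A <- S | (A \in S) && (A != ones)) kappa)); last first.
  apply: ler_sum => A /andP[/SP[A_gt0 Agcd _] Aones].
  by apply: max_gap_ratio_ge => //; exact: mx_norm_gt1.
rewrite -big_seq_cond big_const_seq iter_addr_0 -[leRHS]mulr_natr.
have -> : count (fun A => A != ones) S = (size S).-1.
  rewrite -(count_predC (pred1 ones)) count_uniq_mem// onesS.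
  by rewrite add1n.
rewrite -mulrA ler_pM2l// ler_pdivrMl// -natrM ler_nat.
by case: (size S) S2 => //= k; lia.
Qed.
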